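(* Let $X$ be a real Banach space and let $Y$ be an ideal in $X$. (1) If $Y$ is an $M$-ideal in $X$ and $Y$ has non rough (respectively, weakly average non rough, average non rough) norm, then $X$ has non rough (respectively, weakly average non rough, average non rough) norm. (2) If $Y$ is a strict ideal in $X$ and $Y$ has non rough (respectively, weakly average non rough, average non rough) norm, then $X$ has non rough (respectively, weakly average non rough, average non rough) norm. (3) Let $K$ be a compact Hausdorff space with an isolated point. If $X$ has non rough (respectively, weakly average non rough, average non rough) norm, then $C(K,X)$ has non rough (respectively, weakly average non rough, average non rough) norm.
   Context: All Banach spaces are real. $B_{Z}$ denotes the closed unit ball of $Z$. For a closed subspace $Y$ of $X$, $Y^\perp=\{x^*\in X^*: x^*(y)=0\ \forall y\in Y\}$. $Y$ is an ideal in $X$ if $Y^\perp$ is the kernel of a linear projection on $X^*$ of norm one. $Y$ is an $M$-ideal in $X$ if there is a linear projection $P:X^*\to X^*$ with $\ker P=Y^\perp$ and $\|x^*\|=\|Px^*\|+\|x^*-Px^*\|$ for all $x^*\in X^*$. $Y$ is a strict ideal in $X$ if there is a linear projection $P:X^*\to X^*$ with $\|P\|=1$, $\ker P=Y^\perp$, such that $B_{P(X^* )}$ is $w^*$-dense in $B_{X^*}$. $C(K,X)$ is the space of continuous $X$-valued functions on $K$ with the supremum norm. For a Banach space $Z$, a $w^*$-slice of $B_{Z^*}$ is a set $S(B_{Z^*},z,\alpha)=\{z^*\in B_{Z^*}: z^*(z)>\sup_{y^*\in B_{Z^*}}y^*(z)-\alpha\}$ with $z\in Z$, $\alpha>0$.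 A convex combination of sets $S_1,\dots,S_n$ is $\sum_{i=1}^n\lambda_iS_i$ (Minkowski sum) with $\lambda_i>0$, $\sum_i\lambda_i=1$. For $\varepsilon>0$, the norm of $Z$ is: $\varepsilon$-rough if every $w^*$-slice of $B_{Z^*}$ has diameter $\geq\varepsilon$; weakly $\varepsilon$-average rough if every nonempty relatively $w^*$-open subset of $B_{Z^*}$ has diameter $\geq\varepsilon$; $\varepsilon$-average rough if every convex combination of $w^*$-slices of $B_{Z^*}$ has diameter $\geq\varepsilon$. The norm of $Z$ is non rough (resp. weakly average non rough, average non rough) if for no $\varepsilon>0$ is it $\varepsilon$-rough (resp. weakly $\varepsilon$-average rough, $\varepsilon$-average rough). *)

(* Defs.v *)
From HB Require Import structures.
From mathcomp Require Import all_boot all_order all_algebra.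
From mathcomp Require Import all_classical all_reals all_analysis.

Set Implicit Arguments.
Unset Strict Implicit.
Unset Printing Implicit Defensive.

Import Order.TTheory GRing.Theory Num.Theory.
Import numFieldNormedType.Exports.

Local Open Scope classical_set_scope.
Local Open Scope ring_scope.

Definition unit_ball (R : realType) (V : normedModType R) : set V :=
  [set x | `|x| <= 1].
Arguments unit_ball {R} V.

(* The real supremum of an unbounded set is 0 in the library, so that
   [opnorm f = 1] entails that the linear map [f] is bounded. *)
Definition opnorm (R : realType) (V W : normedModType R) (f : V -> W) : R :=
  sup [set `|f x| | x in unit_ball V].

Section dual.
Context {R : realType} (X : normedModType R).

Definition dual_pred : {pred X -> R^o} :=
  mem [set f : X -> R^o | linear f /\ continuous f].

Record dual := Dual { dual_fun :> X -> R^o; dualP : dual_fun \in dual_pred }.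

HB.instance Definition _ := [isSub for dual_fun].
HB.instance Definition _ := [Choice of dual by <:].

Lemma dual_submod_closed : submod_closed dual_pred.
Proof.
split.
  rewrite inE; split; first by move=> a x y /=; rewrite scaler0 addr0.
  by move=> x; exact: cvg_cst.
move=> a f g; rewrite !inE => -[lf cf] [lg cg]; split=> [b x y|x].
  rewrite !fctE lf lg !scalerDr addrACA; congr (_ + _ + _).
  by rewrite !scalerA mulrC.
by apply: cvgD; [apply: cvgZr; exact: cf|exact: cg].
Qed.

HB.instance Definition _ :=
  GRing.isSubmodClosed.Build R (X -> R^o) dual_pred dual_submod_closed.
HB.instance Definition _ := [SubChoice_isSubLmodule of dual by <:].

Lemma dual_linear (f : dual) : linear f.
Proof. by have := dualP f; rewrite inE => -[]. Qed.

HB.instance Definition _ (f : dual) :=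
  GRing.isLinear.Build R X R^o _ (dual_fun f) (dual_linear f).

Lemma dual_continuous (f : dual) : continuous f.
Proof. by have := dualP f; rewrite inE => -[]. Qed.

Lemma dual_has_sup (f : dual) : has_sup [set `|f x| | x in unit_ball X].
Proof.
split; first by exists `|f 0|, 0; rewrite // /unit_ball /= normr0 ler01.
have /bounded_funP/(_ 1)[M fM] :=
  @continuous_linear_bounded _ _ _ 0 (dual_fun f) (@dual_continuous f 0).
by exists M => _ [x x1 <-]; exact: fM.
Qed.

Lemma opnorm_ub (f : dual) (x : X) : unit_ball X x -> `|f x| <= opnorm f.
Proof.
by move=> x1; apply: sup_upper_bound; [exact: dual_has_sup|exists x].
Qed.

Lemma dual_normD (f g : dual) : opnorm (f + g) <= opnorm f + opnorm g.
Proof.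
apply: ge_sup; first by case: (dual_has_sup (f + g)).
move=> _ [x x1 <-]; rewrite (le_trans (ler_normD _ _))//.
by rewrite lerD// opnorm_ub.
Qed.

Lemma dual_normZ (a : R) (f : dual) : opnorm (a *: f) = `|a| * opnorm f.
Proof.
have le b (g : dual) : opnorm (b *: g) <= `|b| * opnorm g.
  apply: ge_sup; first by case: (dual_has_sup (b *: g)).
  by move=> _ [x x1 <-]; rewrite normrZ ler_wpM2l// opnorm_ub.
apply/eqP; rewrite eq_le le/=; have [->|a0] := eqVneq a 0.
  rewrite normr0 mul0r (le_trans (normr_ge0 ((0 *: f : dual) 0)))//.
  by rewrite opnorm_ub// /unit_ball /= normr0 ler01.
rewrite -ler_pdivlMl ?normr_gt0// -normfV.
by have := le a^-1 (a *: f); rewrite scalerA mulVf// scale1r.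
Qed.

Lemma dual_norm0_eq0 (f : dual) : opnorm f = 0 -> f = 0.
Proof.
move=> f0; apply/val_inj/funext => x; change (f x = 0).
have [->|x0] := eqVneq x 0; first by rewrite linear0.
have : `|f (`|x|^-1 *: x)| <= 0.
  rewrite -f0 opnorm_ub// /unit_ball /= normrZ normfV normr_id mulVf//.
  by rewrite normr_eq0.
rewrite normr_le0 linearZ/= scaler_eq0 invr_eq0 normr_eq0 (negbTE x0).
by move/eqP.
Qed.

HB.instance Definition _ :=
  @Lmodule_isNormed.Build R dual (fun f => opnorm f)
    dual_normD dual_normZ dual_norm0_eq0.

Definition wstar := initial_topology (dual_fun : dual -> {ptws X -> R^o}).
HB.instance Definition _ := Topological.on wstar.

End dual.

Section roughness.
Context {R : realType} (Z : normedModType R).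
Implicit Types S : set (dual Z).

Definition wstar_slice (z : Z) (alpha : R) : set (dual Z) :=
  [set f | unit_ball (dual Z) f /\
           f z > sup [set g z | g in unit_ball (dual Z)] - alpha].

Definition is_wstar_slice S : Prop :=
  exists z alpha, 0 < alpha /\ S = wstar_slice z alpha.

Definition relatively_wstar_open S : Prop :=
  exists2 U : set (wstar Z), open U & S = U `&` unit_ball (dual Z).

Definition is_convex_combination_of_slices S : Prop :=
  exists (n : nat) (lambda : 'I_n -> R) (T : 'I_n -> set (dual Z)),
    [/\ forall i, 0 < lambda i,
        \sum_i lambda i = 1,
        forall i, is_wstar_slice (T i) &
        S = [set \sum_i lambda i *: f i | f in [set f | forall i, T i (f i)]]].

Definition diameter S : \bar R :=
  ereal_sup [set `|p.1 - p.2|%:E | p in S `*` S].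

Definition rough (eps : R) : Prop :=
  forall S, is_wstar_slice S -> (eps%:E <= diameter S)%E.

Definition weakly_average_rough (eps : R) : Prop :=
  forall S, S !=set0 -> relatively_wstar_open S -> (eps%:E <= diameter S)%E.

Definition average_rough (eps : R) : Prop :=
  forall S, is_convex_combination_of_slices S -> (eps%:E <= diameter S)%E.

Definition non_rough : Prop := ~ exists2 eps, 0 < eps & rough eps.

Definition weakly_average_non_rough : Prop :=
  ~ exists2 eps, 0 < eps & weakly_average_rough eps.

Definition average_non_rough : Prop :=
  ~ exists2 eps, 0 < eps & average_rough eps.

End roughness.

Record closed_subspace (R : realType) (X : normedModType R) := ClosedSubspace {
  subspace_set :> set X;
  subspace_closed : closed subspace_set;
  subspace_submod : submod_closed (mem subspace_set) }.

Section subspace_normed.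
Context {R : realType} {X : normedModType R} (Y : closed_subspace X).

Definition subspace_pred : {pred X} := mem (Y : set X).

HB.instance Definition _ :=
  GRing.isSubmodClosed.Build R X subspace_pred (subspace_submod Y).

(* [Y] as a normed space in its own right, with the norm of [X]. *)
Record subspace_type :=
  SubspaceElt { subspace_val :> X; subspace_valP : subspace_val \in subspace_pred }.

HB.instance Definition _ := [isSub for subspace_val].
HB.instance Definition _ := [Choice of subspace_type by <:].
HB.instance Definition _ := [SubChoice_isSubLmodule of subspace_type by <:].

Lemma subspace_normD (x y : subspace_type) :
  `|val (x + y)| <= `|val x| + `|val y|.
Proof. exact: ler_normD. Qed.

Lemma subspace_normZ (a : R) (x : subspace_type) :
  `|val (a *: x)| = `|a| * `|val x|.
Proof. exact: normrZ. Qed.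

Lemma subspace_norm0_eq0 (x : subspace_type) : `|val x| = 0 -> x = 0.
Proof. by move/normr0_eq0 => x0; exact: val_inj. Qed.

HB.instance Definition _ :=
  @Lmodule_isNormed.Build R subspace_type (fun x => `|val x|)
    subspace_normD subspace_normZ subspace_norm0_eq0.

End subspace_normed.

Section ideals.
Context {R : realType} {X : normedModType R} (Y : closed_subspace X).

Definition annihilator : set (dual X) :=
  [set f | forall y, (Y : set X) y -> f y = 0].

Definition projection_along_annihilator (P : {linear dual X -> dual X}) : Prop :=
  (forall f, P (P f) = P f) /\ [set f | P f = 0] = annihilator.

Definition is_ideal : Prop :=
  exists P : {linear dual X -> dual X},
    projection_along_annihilator P /\ opnorm P = 1.

Definition is_M_ideal : Prop :=
  exists P : {linear dual X -> dual X},
    projection_along_annihilator P /\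
    forall f, `|f| = `|P f| + `|f - P f|.

Definition is_strict_ideal : Prop :=
  exists P : {linear dual X -> dual X},
    [/\ projection_along_annihilator P,
        opnorm P = 1 &
        unit_ball (dual X) `<=`
          closure (range P `&` unit_ball (dual X) : set (wstar X))].

End ideals.

Definition cts_pred (R : realType) (K : topologicalType) (X : normedModType R) :
  {pred K -> X} := mem [set f : K -> X | continuous f].
Arguments cts_pred {R} K X.

(* C(K, X). Compactness of [K] is a parameter of the type because the
   supremum norm is not finite without it. *)
Record cts_space (R : realType) (K : topologicalType) (cK : compact [set: K])
    (X : normedModType R) :=
  CtsFun { cts_fun :> K -> X; cts_funP : cts_fun \in cts_pred K X }.

Section continuous_functions.
Context {R : realType} {K : topologicalType} (cK : compact [set: K])
  (X : normedModType R).
Local Notation cts_space := (cts_space cK X).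
Local Notation cts_fun := (@cts_fun R K cK X).
Local Notation cts_pred := (cts_pred K X).

HB.instance Definition _ := [isSub for cts_fun].
HB.instance Definition _ := [Choice of cts_space by <:].

Lemma cts_submod_closed : submod_closed cts_pred.
Proof.
split; first by rewrite inE => x; exact: cvg_cst.
move=> a f g; rewrite !inE => cf cg x.
by apply: cvgD; [apply: cvgZr; exact: cf|exact: cg].
Qed.

HB.instance Definition _ :=
  GRing.isSubmodClosed.Build R (K -> X) cts_pred cts_submod_closed.
HB.instance Definition _ := [SubChoice_isSubLmodule of cts_space by <:].

Definition sup_norm (f : cts_space) : R := sup (range (fun t => `|f t|)).

Lemma sup_norm_ub (f : cts_space) (t : K) : `|f t| <= sup_norm f.
Proof.
apply: ub_le_sup; last by exists t.
have cf : continuous f by have := cts_funP f; rewrite inE.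
have /compact_bounded[M [_ fM]] :=
  continuous_compact (continuous_subspaceT cf) cK.
exists (M + 1) => _ [s _ <-]; apply: fM; first by rewrite ltrDl.
by exists s.
Qed.

Lemma sup_norm_le (f : cts_space) (M : R) :
  0 <= M -> (forall t, `|f t| <= M) -> sup_norm f <= M.
Proof.
move=> M0 fM; rewrite /sup_norm.
have [->|ne] := eqVneq (range (fun t => `|f t|)) set0; first by rewrite sup0.
by apply: ge_sup => [|_ [t _ <-]//]; apply/set0P.
Qed.

Lemma sup_norm_ge0 (f : cts_space) : 0 <= sup_norm f.
Proof.
rewrite /sup_norm; have [->|/set0P[_ [t _ _]]] :=
  eqVneq (range (fun t => `|f t|)) set0; first by rewrite sup0.
exact: le_trans (normr_ge0 _) (sup_norm_ub f t).
Qed.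

Lemma sup_normD (f g : cts_space) : sup_norm (f + g) <= sup_norm f + sup_norm g.
Proof.
apply: sup_norm_le => [|t]; first by rewrite addr_ge0 ?sup_norm_ge0.
by rewrite (le_trans (ler_normD _ _))// lerD// sup_norm_ub.
Qed.

Lemma sup_normZ (a : R) (f : cts_space) : sup_norm (a *: f) = `|a| * sup_norm f.
Proof.
have le b (g : cts_space) : sup_norm (b *: g) <= `|b| * sup_norm g.
  apply: sup_norm_le => [|t]; first by rewrite mulr_ge0 ?sup_norm_ge0.
  by rewrite normrZ ler_wpM2l// sup_norm_ub.
apply/eqP; rewrite eq_le le/=; have [->|a0] := eqVneq a 0.
  by rewrite normr0 mul0r sup_norm_ge0.
rewrite -ler_pdivlMl ?normr_gt0// -normfV.
by have := le a^-1 (a *: f); rewrite scalerA mulVf// scale1r.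
Qed.

Lemma sup_norm0_eq0 (f : cts_space) : sup_norm f = 0 -> f = 0.
Proof.
move=> f0; apply/val_inj/funext => t; apply/eqP.
by rewrite -normr_le0 -f0 sup_norm_ub.
Qed.

HB.instance Definition _ :=
  @Lmodule_isNormed.Build R cts_space sup_norm sup_normD sup_normZ sup_norm0_eq0.

End continuous_functions.

(* Main.v *)
(* In all three parts there are a linear isometry [j : Y -> X], a linear map [P]
   on [X^*] with [|P f| <= |f o j|], and a w*-dense subset [D] of the unit ball of
   [X^*] on which [|f - P f| <= 1 - |f o j|]: for an M-ideal, [P] is the
   L-projection and [D] the whole ball; for a strict ideal, [D] is the unit ball
   of the range of [P]; for an isolated point [k], [j x] is [x] at [k] and [0]
   elsewhere, [P f h = f (j (h k))], and [D] is the whole ball.  Hence if slices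
   (or a relatively w*-open set) of the unit ball of [Y^*] are small and consist
   of functionals of norm close to 1, their preimages under [f |-> f o j] are
   small as well, by approximating with elements of [D].  Any slice can be shrunk
   so as to be close to the unit sphere, and a relatively w*-open set can be moved
   there by an affine change of variable. *)
From HB Require Import structures.
Require Import Defs.
From mathcomp Require Import all_boot all_order all_algebra.
From mathcomp Require Import all_classical all_reals all_analysis.
From mathcomp Require Import lra.

Set Implicit Arguments.
Unset Strict Implicit.
Unset Printing Implicit Defensive.

Import Order.TTheory GRing.Theory Num.Theory.
Import numFieldNormedType.Exports.

Local Open Scope classical_set_scope.
Local Open Scope ring_scope.

(** * The Hahn-Banach theorem with cone constraints *)

Section hahn_banach.
Context {R : realType} {V : lmodType R}.
Implicit Types (p q : V -> R) (C : set (V * R)).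

Definition sublinear p :=
  (forall x y, p (x + y) <= p x + p y) /\
  (forall (t : R) (x : V), 0 <= t -> p (t *: x) <= t * p x).

(** A pair [(x, c)] of the convex cone [C] encodes the constraint [c <= f x] on the functional
    sought. *)
Definition cone C :=
  [/\ C (0, 0), forall a b, C a -> C b -> C (a.1 + b.1, a.2 + b.2) &
      forall (t : R) a, 0 <= t -> C a -> C (t *: a.1, t * a.2)].

Lemma sublinear0 p : sublinear p -> p 0 = 0.
Proof.
move=> [pD pZ]; apply/eqP; rewrite eq_le.
have := pZ 0 0 (lexx 0); have := pD 0 0; rewrite addr0 scaler0; lra.
Qed.

Lemma sublinear_homogeneous p (t : R) (x : V) : sublinear p -> 0 <= t ->
  p (t *: x) = t * p x.
Proof.
move=> sp; have [_ pZ] := sp; rewrite le_eqVlt => /predU1P[<-|t0].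
  by rewrite scale0r mul0r sublinear0.
apply/eqP; rewrite eq_le pZ ?(ltW t0)//= -ler_pdivlMl//.
have := pZ t^-1 (t *: x); rewrite scalerA mulVf ?gt_eqF// scale1r.
by apply; rewrite invr_ge0 ltW.
Qed.

Lemma sublinear_ge p x : sublinear p -> - p (- x) <= p x.
Proof.
move=> sp; have [pD _] := sp.
by have := pD x (- x); rewrite subrr sublinear0//; lra.
Qed.

(* The largest sublinear functional [q <= p] with [c <= - q (- u)] on [C]. *)
Definition cone_inf p C (x : V) : R := inf [set p (x + a.1) - a.2 | a in C].

Section cone_inf.
Variables (p : V -> R) (C : set (V * R)).
Hypotheses (sp : sublinear p) (coneC : cone C).
Hypothesis Cp : forall a, C a -> a.2 <= p a.1.

Let has_inf_C x : has_inf [set p (x + a.1) - a.2 | a in C].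
Proof.
have [C0 _ _] := coneC; have [pD _] := sp; split.
  by exists (p (x + 0) - 0), (0, 0).
exists (- p (- x)) => _ [a /Cp ap <-].
have := pD (- x) (x + a.1); rewrite addKr; lra.
Qed.

Lemma cone_inf_le a x : C a -> cone_inf p C x <= p (x + a.1) - a.2.
Proof. by move=> Ca; apply: ge_inf; [case: (has_inf_C x)|exists a]. Qed.

(** Adding two elements of the cone gives subadditivity; rescaling one of them gives homogeneity. *)
Lemma cone_inf_sublinear : sublinear (cone_inf p C).
Proof.
have [pD pZ] := sp; have [C0 CD CZ] := coneC; split=> [x y|t x].
  rewrite -lerBlDr; apply: lb_le_inf; first by case: (has_inf_C x).
  move=> _ [a Ca <-]; rewrite lerBlDr -lerBlDl.
  apply: lb_le_inf; first by case: (has_inf_C y).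
  move=> _ [b Cb <-]; have /= := cone_inf_le (x + y) (CD _ _ Ca Cb).
  by rewrite addrACA; have := pD (x + a.1) (y + b.1); lra.
rewrite le_eqVlt => /predU1P[<-|t0].
  rewrite scale0r mul0r (le_trans (cone_inf_le 0 C0))//.
  by rewrite addr0 sublinear0// subrr.
rewrite -ler_pdivrMl//; apply: lb_le_inf; first by case: (has_inf_C x).
move=> _ [a Ca <-]; rewrite ler_pdivrMl//.
have /= := cone_inf_le (t *: x) (CZ _ _ (ltW t0) Ca).
by rewrite -scalerDr (sublinear_homogeneous _ sp (ltW t0)); lra.
Qed.

End cone_inf.

(** Zorn's lemma: a nonempty chain is bounded below by its pointwise infimum, which is finite
    because every sublinear [q <= p] satisfies [- p (- x) <= q x]. *)
Lemma minimal_sublinear p : sublinear p ->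
  exists q, [/\ sublinear q, forall x, q x <= p x &
    forall r, sublinear r -> (forall x, r x <= q x) -> forall x, q x <= r x].
Proof.
move=> sp; pose T := {q | sublinear q /\ forall x, q x <= p x}.
(* The order is reversed, so that a maximal element for [below] is a minimal functional. *)
pose below (q r : T) : bool := `[< forall x, sval r x <= sval q x >].
have [| | |q qmin] := @ZL_preorder T (exist _ p (conj sp (fun=> lexx _))) below.
- by move=> q; apply/asboolP.
- move=> a b c /asboolP ab /asboolP bc; apply/asboolP => x.
  exact: le_trans (bc x) (ab x).
- move=> A Atot; have [[q0 Aq0]|/forallNP A0] := pselect (exists t, A t);
    last by exists (exist _ p (conj sp (fun=> lexx _))) => s /A0.
  pose m x := inf [set sval t x | t in A].
  have mi x : has_inf [set sval t x | t in A].
    split; first by exists (sval q0 x), q0.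
    exists (- p (- x)) => _ [[q [sq qp]] _ <-] /=.
    by apply: le_trans (sublinear_ge x sq); rewrite lerN2.
  have m_le (t : T) x : A t -> m x <= sval t x.
    by move=> At; apply: ge_inf; [case: (mi x)|exists t].
  have sm : sublinear m.
    split=> [x y|t x].
      rewrite -lerBlDr; apply: lb_le_inf; first by case: (mi x).
      move=> _ [a Aa <-]; rewrite lerBlDr -lerBlDl.
      apply: lb_le_inf; first by case: (mi y).
      move=> _ [b Ab <-]; rewrite lerBlDl.
      have [/asboolP ab|/asboolP ba] := Atot _ _ Aa Ab.
        apply: le_trans (m_le b _ Ab) _.
        case: b ab {Ab} => b [[bD _] _]/= ab; apply: le_trans (bD _ _) _.
        by rewrite lerD2r.
      apply: le_trans (m_le a _ Aa) _.
      case: a ba {Aa} => a [[aD _] _]/= ba; apply: le_trans (aD _ _) _.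
      by rewrite lerD2l.
    rewrite le_eqVlt => /predU1P[<-|t0].
      rewrite scale0r mul0r (le_trans (m_le _ _ Aq0))//.
      by case: (q0) => /= q [sq _]; rewrite sublinear0.
    rewrite -ler_pdivrMl//; apply: lb_le_inf; first by case: (mi x).
    move=> _ [a Aa <-]; rewrite ler_pdivrMl//.
    apply: le_trans (m_le a _ Aa) _; case: a {Aa} => a [sa _] /=.
    by rewrite sublinear_homogeneous// ltW.
  have mp x : m x <= p x.
    exact: le_trans (m_le _ _ Aq0) ((svalP q0).2 x).
  by exists (exist _ m (conj sm mp)) => s As; apply/asboolP => x /=; exact: m_le.
case: q qmin => q [sq qp] qmin; exists q; split=> // r sr rq.
have rp x : r x <= p x by apply: le_trans (rq x) (qp x).
by have /asboolP := qmin (exist _ r (conj sr rp)) (introT (asboolP _) rq).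
Qed.

(* Comparing [q] with its [cone_inf] over the ray through [(y, q y)] gives
   [q x + q y <= q (x + y)]. *)
Lemma minimal_sublinear_linear q : sublinear q ->
  (forall r, sublinear r -> (forall x, r x <= q x) -> forall x, q x <= r x) ->
  linear (q : V -> R^o).
Proof.
move=> sq qmin; have [qD qZ] := sq.
have qDE x y : q (x + y) = q x + q y.
  apply/eqP; rewrite eq_le qD/=.
  pose C : set (V * R) := [set (t *: y, t * q y) | t in [set t : R | 0 <= t]].
  have C0 : C (0, 0) by exists 0; rewrite /= ?scale0r ?mul0r.
  have coneC : cone C.
    split=> // [_ _ [s s0 <-] [t t0 <-]|s _ s0 [t t0 <-]] /=.
      by exists (s + t); rewrite /= ?addr_ge0// scalerDl mulrDl.
    by exists (s * t); rewrite /= ?mulr_ge0// scalerA mulrA.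
  have Cq a : C a -> a.2 <= q a.1.
    by move=> [t t0 <-]/=; rewrite sublinear_homogeneous.
  have Cy : C (y, q y) by exists 1; rewrite /= ?scale1r ?mul1r.
  have le_q z : cone_inf q C z <= q z.
    by have := cone_inf_le sq coneC Cq z C0; rewrite /= addr0 subr0.
  rewrite -lerBrDr (le_trans (qmin _ (cone_inf_sublinear sq coneC Cq) le_q x))//.
  exact: (cone_inf_le sq coneC Cq x Cy).
have qN x : q (- x) = - q x.
  by have := qDE x (- x); rewrite subrr sublinear0//; lra.
move=> a x y; rewrite qDE; congr (_ + _).
have [a0|a0] := leP 0 a; first exact: sublinear_homogeneous.
rewrite -[a]opprK scaleNr qN sublinear_homogeneous// ?oppr_ge0 1?ltW//.
by rewrite [in RHS]scaleNr.
Qed.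

(** A minimal [q] below [cone_inf p C] works: the pair [(0, 0)] gives [q <= p], and the pair [a] at
    the point [- a.1] gives [q (- a.1) <= - a.2]. *)
Theorem hahn_banach p C : sublinear p -> cone C ->
  (forall a, C a -> a.2 <= p a.1) ->
  exists f : V -> R^o,
    [/\ linear f, forall x, f x <= p x & forall a, C a -> a.2 <= f a.1].
Proof.
move=> sp coneC Cp.
have [q [sq qp qmin]] := minimal_sublinear (cone_inf_sublinear sp coneC Cp).
have lq := minimal_sublinear_linear sq qmin.
have [C0 _ _] := coneC.
exists q; split=> // [x|a Ca].
  apply: le_trans (qp x) _.
  by have := cone_inf_le sp coneC Cp x C0; rewrite /= addr0 subr0.
have := le_trans (qp (- a.1)) (cone_inf_le sp coneC Cp (- a.1) Ca).
rewrite addNr sublinear0// sub0r.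
have := lq (-1) a.1 0; rewrite addr0 scaleN1r => ->.
by rewrite sublinear0// addr0 scaleN1r lerN2.
Qed.

End hahn_banach.

(** * Dual norm, norming functionals and the w*-topology *)

Section dual_space.
Context {R : realType} {V : normedModType R}.
Implicit Types f g : dual V.

Lemma linear_contraction_continuous (W : normedModType R) (M : R)
  (f : {linear V -> W}) : (forall x, `|f x| <= M * `|x|) -> continuous f.
Proof.
move=> fM; apply/linear_bounded_continuous/linear_boundedP.
near=> r => x; apply: le_trans (fM x) _; apply: ler_wpM2r => //.
Unshelve. all: by end_near. Qed.

Lemma exists_dual (f : V -> R^o) (M : R) : linear f ->
  (forall x, `|f x| <= M * `|x|) -> exists g : dual V, dual_fun g = f.
Proof.
move=> lf fM; pose F := GRing.isLinear.Build R V R^o _ f lf.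
pose f' : {linear V -> R^o} := HB.pack f F.
have fV : f \in @dual_pred R V.
  by rewrite inE; split=> //; exact: (@linear_contraction_continuous _ M f').
by exists (Dual fV).
Qed.

Lemma dual_le_norm f x : `|f x| <= `|f| * `|x|.
Proof.
have [->|x0] := eqVneq x 0; first by rewrite linear0 !normr0 mulr0.
have nx : 0 < `|x| by rewrite normr_gt0.
have : `|f (`|x|^-1 *: x)| <= `|f|.
  by apply: opnorm_ub; rewrite /unit_ball /= normrZ normfV normr_id mulVf ?gt_eqF.
by rewrite linearZ/= normrM normfV normr_id mulrC ler_pdivrMr.
Qed.

(** A one-sided bound suffices because the unit ball is symmetric. *)
Lemma dual_norm_le f (M : R) :
  (forall x, unit_ball V x -> f x <= M) -> `|f| <= M.
Proof.
move=> fM; apply: ge_sup; first by case: (dual_has_sup f).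
move=> _ [x x1 <-]; rewrite ler_norml fM// andbT lerNl -[leLHS](linearN f).
by apply: fM; rewrite /unit_ball /= normrN.
Qed.

Lemma dual_norm_gt f (M : R) : M < `|f| -> exists2 x, unit_ball V x & M < f x.
Proof.
move=> Mf; apply: contrapT => fM; move: Mf; apply/negP; rewrite -leNgt.
apply: dual_norm_le => x x1; rewrite leNgt; apply/negP => Mx.
by apply: fM; exists x.
Qed.

Lemma dual_le1 f x : unit_ball (dual V) f -> f x <= `|x|.
Proof.
move=> f1; apply: le_trans (ler_norm _) _; apply: le_trans (dual_le_norm f x) _.
by rewrite ler_piMl.
Qed.

Lemma dual_sumE n (f : 'I_n -> dual V) x : (\sum_i f i) x = \sum_i f i x.
Proof.
by elim/big_rec2: _ => // i a b _ <-.
Qed.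

Lemma hahn_banach_dual (M : R) (C : set (V * R)) : 0 <= M -> cone C ->
  (forall a, C a -> a.2 <= M * `|a.1|) ->
  exists2 f : dual V, `|f| <= M & forall a, C a -> a.2 <= f a.1.
Proof.
move=> M0 coneC CM.
have sM : sublinear (fun x : V => M * `|x|).
  split=> [x y|t x t0]; first by rewrite -mulrDr ler_wpM2l// ler_normD.
  by rewrite normrZ ger0_norm// mulrCA.
have [f [lf fM Cf]] := hahn_banach sM coneC CM.
have [|g gf] := @exists_dual f M lf.
  move=> x; rewrite ler_norml fM andbT lerNl.
  (* These two instances of linearity give [f 0 = 0] and [f (- x) = - f x]. *)
  have := lf (-1) x 0; rewrite addr0 scaleN1r.
  have := lf (-1) 0 0; rewrite scaler0 addr0 scaleN1r addNr => ->.
  rewrite addr0 scaleN1r => <-.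
  by rewrite -(normrN x).
exists g; rewrite ?gf//; apply: dual_norm_le => x x1; rewrite gf.
by apply: le_trans (fM x) _; rewrite ler_piMr.
Qed.

(** Hahn-Banach with bound 1 for the ray through [(x, |x|)]. *)
Lemma norming_functional x :
  exists2 f : dual V, unit_ball (dual V) f & f x = `|x|.
Proof.
pose C : set (V * R) := [set (t *: x, t * `|x|) | t in [set t : R | 0 <= t]].
have coneC : cone C.
  split=> [|_ _ [s s0 <-] [t t0 <-]|s _ s0 [t t0 <-]] /=.
  - by exists 0; rewrite /= ?scale0r ?mul0r.
  - by exists (s + t); rewrite /= ?addr_ge0// scalerDl mulrDl.
  - by exists (s * t); rewrite /= ?mulr_ge0// scalerA mulrA.
have [|f f1 Cf] := hahn_banach_dual ler01 coneC.
  by move=> _ [t t0 <-] /=; rewrite normrZ ger0_norm// mul1r.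
exists f => //; apply/eqP; rewrite eq_le dual_le1//=.
by apply: (Cf (x, `|x|)); exists 1; rewrite /= ?scale1r ?mul1r.
Qed.

(** The supremum in the definition of a slice is attained at a norming functional of [z]. *)
Lemma wstar_sliceE z (alpha : R) : wstar_slice z alpha =
  [set f | unit_ball (dual V) f /\ `|z| - alpha < f z].
Proof.
suff -> : `|z| = sup [set g z | g in unit_ball (dual V)] by [].
have [g g1 gz] := norming_functional z.
apply/eqP; rewrite eq_le; apply/andP; split.
  apply: ub_le_sup; last by exists g.
  by exists `|z| => _ [h h1 <-]; exact: dual_le1.
by apply: ge_sup => [|_ [h h1 <-]]; [exists (g z), g|exact: dual_le1].
Qed.

Lemma wstar_eval_continuous x : continuous (fun f : wstar V => dual_fun f x : R^o).
Proof.
move=> f; apply: (@continuous_comp (wstar V) {ptws V -> R^o} R^o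
  (@dual_fun R V : wstar V -> {ptws V -> R^o}) (fun h => h x)).
- exact: initial_continuous.
- exact: proj_continuous.
Qed.

Lemma wstar_continuous (T : topologicalType) (h : T -> wstar V) :
  (forall x, continuous (fun t => dual_fun (h t) x : R^o)) -> continuous h.
Proof.
move=> hc; apply: continuous_comp_initial => t; apply/pointwise_cvgP => x.
exact: hc.
Qed.

Lemma open_wstar_gt x (c : R) : open ([set f | c < dual_fun f x] : set (wstar V)).
Proof.
have /continuousP/(_ [set r | c < r]) := @wstar_eval_continuous x; apply.
exact: open_gt.
Qed.

Lemma wstar_slice_open S : is_wstar_slice S ->
  exists2 U : set (wstar V), open U & S = U `&` unit_ball (dual V).
Proof.
move=> [z [a [_ ->]]]; rewrite wstar_sliceE.
exists [set f | `|z| - a < dual_fun f z]; first exact: open_wstar_gt.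
by rewrite setIC.
Qed.

End dual_space.

(** * The adjoint of a contraction *)

Section precomposition.
Context {R : realType} {Y X : normedModType R} (j : {linear Y -> X}).
Hypothesis j_le : forall y, `|j y| <= `|y|.

Lemma precomp_dual_pred (f : dual X) : (dual_fun f \o j) \in @dual_pred R Y.
Proof.
rewrite inE; split=> [a x y|y] /=; first by rewrite linearP /= (linearP f).
apply: continuous_comp; last exact: dual_continuous.
by apply: (@linear_contraction_continuous _ _ _ 1) => z; rewrite mul1r.
Qed.

(** The adjoint of [j]; for an inclusion [j] it is the restriction of functionals. *)
Definition precomp (f : dual X) : dual Y := Dual (precomp_dual_pred f).

Lemma precomp_linear : linear precomp.
Proof. by move=> a f g; exact/val_inj/funext. Qed.

HB.instance Definition _ :=
  GRing.isLinear.Build R (dual X) (dual Y) _ precomp precomp_linear.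

Lemma precomp_norm_le f : `|precomp f| <= `|f|.
Proof.
apply: dual_norm_le => y y1; apply: le_trans (ler_norm _) _.
exact: (@opnorm_ub _ _ f (j y) (le_trans (j_le y) y1)).
Qed.

Lemma precomp_wstar_continuous : continuous (precomp : wstar X -> wstar Y).
Proof.
apply: (@wstar_continuous R Y (wstar X) precomp) => y.
exact: (@wstar_eval_continuous _ _ (j y)).
Qed.

End precomposition.

(** * Diameters as bounds on pairwise distances *)

Section diameter.
Context {R : realType} {Z : normedModType R}.
Implicit Types (S : set (dual Z)) (e : R).

Lemma diameter_le S e : (forall f g, S f -> S g -> `|f - g| <= e) ->
  (diameter S <= e%:E)%E.
Proof.
by move=> Se; apply: ge_ereal_sup => _ [[f g] [/= Sf Sg] <-]; rewrite lee_fin Se.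
Qed.

Lemma le_diameterN S e : ~ (e%:E <= diameter S)%E ->
  forall f g, S f -> S g -> `|f - g| <= e.
Proof.
move=> /negP; rewrite -ltNge => Se f g Sf Sg; rewrite -lee_fin.
by apply: le_trans (ltW Se); apply: ereal_sup_ubound; exists (f, g).
Qed.

End diameter.

(** * Small sets moved close to the dual unit sphere *)

Section refinement.
Context {R : realType} {Y : normedModType R}.

(** In a slice at [y != 0] of width at most [eta * |y|], one has
    [(1 - eta) * |y| < f y <= |f| * |y|]; the given slice is narrowed to that width. *)
Lemma wstar_slice_refine (y0 : Y) (eta : R) (S : set (dual Y)) : y0 != 0 -> 0 < eta ->
  is_wstar_slice S -> exists y (alpha : R), [/\ 0 < alpha,
    wstar_slice y alpha `<=` S &
    forall f : dual Y, wstar_slice y alpha f -> 1 - eta < `|f|].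
Proof.
move=> y00 eta0 [z [a [a0 ->]]].
have near1 (y : Y) (b : R) (f : dual Y) : y != 0 -> b <= eta * `|y| -> wstar_slice y b f ->
    1 - eta < `|f|.
  move=> y0' b_eta; rewrite wstar_sliceE => -[f1 fy].
  have ny : 0 < `|y| by rewrite normr_gt0.
  rewrite -(ltr_pM2r ny) mulrBl mul1r; apply: lt_le_trans (dual_le_norm f y).
  by apply: lt_le_trans (ler_norm _); apply: le_lt_trans fy; rewrite lerD2l lerN2.
(* The slice at [0] is the whole ball, so it contains any slice at [y0]. *)
have [->|z0] := eqVneq z 0.
  exists y0, (eta * `|y0|); rewrite mulr_gt0 ?normr_gt0//; split=> // f.
    rewrite !wstar_sliceE normr0 => -[f1 _]; split=> //.
    by rewrite linear0 sub0r oppr_lt0.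
  exact: near1.
exists z, (Num.min a (eta * `|z|)); split.
- by rewrite lt_min a0 mulr_gt0 ?normr_gt0.
- move=> f; rewrite !wstar_sliceE => -[f1 fz]; split=> //.
  by apply: le_lt_trans fz; rewrite lerD2l lerN2 ge_min lexx.
- by move=> f; apply: near1; rewrite // ge_min lexx orbT.
Qed.

(* If all of [U] stays inside the ball of radius [1 - eta], then the scaled copy
   of [U] obtained by pulling it back along [f |-> g0 + (eta / 2) (f - g1)],
   which maps the unit ball to itself, contains the norm one functional [g1]. *)
Lemma wstar_open_refine (y0 : Y) (eta d : R) (S : set (dual Y)) :
  y0 != 0 -> 0 < eta -> eta <= 1 -> S !=set0 -> relatively_wstar_open S ->
  (forall f g, S f -> S g -> `|f - g| <= eta / 2 * d) ->
  exists U : set (wstar Y), [/\ open U,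
    exists g : dual Y, [/\ U g, unit_ball (dual Y) g & 1 - eta < `|g|] &
    forall f g : dual Y, unit_ball (dual Y) f -> unit_ball (dual Y) g ->
      U f -> U g -> `|f - g| <= d].
Proof.
move=> y00 eta0 eta1 [g0 Sg0] [U oU SU] Sd.
have eta2 : 0 < eta / 2 by rewrite divr_gt0.
have d0 : 0 <= d.
  by have := Sd _ _ Sg0 Sg0; rewrite subrr normr0 pmulr_rge0.
(* If [S] already has a point of norm above [1 - eta], [U] itself serves, since [eta / 2 <= 1]. *)
have [[g [Sg geta]]|small] := pselect (exists g, S g /\ 1 - eta < `|g|).
  exists U; split=> //; first by exists g; move: Sg; rewrite SU => -[].
  move=> f h f1 h1 Uf Uh; apply: (@le_trans _ _ (eta / 2 * d)).
    by apply: Sd; rewrite SU.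
  by rewrite ler_piMl//; lra.
have {}small g : S g -> `|g| <= 1 - eta.
  by move=> Sg; rewrite leNgt; apply/negP => ?; apply: small; exists g.
have [g1 g11 g1y] := norming_functional y0.
have g1n : `|g1| = 1.
  apply/eqP; rewrite eq_le g11/= -(@ler_pM2r _ `|y0|) ?normr_gt0// mul1r.
  by have := dual_le_norm g1 y0; rewrite g1y normr_id.
pose h (f : wstar Y) : wstar Y := g0 + (eta / 2) *: ((f : dual Y) - g1).
have hc : continuous h.
  apply: (@wstar_continuous R Y (wstar Y) h) => y f.
  have := @wstar_eval_continuous R Y y f.
  move=> fc; change ((fun t : wstar Y =>
    g0 y + (eta / 2) *: (dual_fun t y - g1 y) : R^o) @ f -->
    (g0 y + (eta / 2) *: (dual_fun f y - g1 y) : R^o)).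
  have cst (c : R^o) : (fun=> c) @ nbhs f --> c by exact: cvg_cst.
  have ff : Filter (nbhs f) := nbhs_filter f.
  have fB := @cvgB R R^o _ (nbhs f) ff (fun t : wstar Y => dual_fun t y)
    (fun=> g1 y) _ _ fc (cst (g1 y)).
  have fZ := @cvgZl_tmp R R^o _ (nbhs f) ff (eta / 2) _ _ fB.
  exact: (@cvgD R R^o _ (nbhs f) ff (fun=> g0 y) _ _ _ (cst (g0 y)) fZ).
(* Here [|g0| <= 1 - eta] leaves room for a displacement of norm at most [eta / 2 * 2 = eta]. *)
have hB (f : dual Y) : unit_ball (dual Y) f -> unit_ball (dual Y) (h f).
  rewrite /unit_ball /= => f1; apply: le_trans (ler_normD _ _) _.
  have := small _ Sg0; rewrite normrZ (gtr0_norm eta2).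
  have := ler_normB f g1; rewrite g1n => fg1.
  suff : eta / 2 * `|f - g1| <= eta / 2 * 2 by lra.
  rewrite ler_pM2l//; lra.
exists (h @^-1` U); split; first by move/continuousP: hc; apply.
  exists g1; split=> //; last by rewrite g1n; lra.
  rewrite /preimage /= /h subrr scaler0 addr0.
  by move: Sg0; rewrite SU => -[].
(* [h] scales distances by exactly [eta / 2], the factor built into the diameter bound on [S]. *)
move=> f g f1 g1' Uf Ug; rewrite -(ler_pM2l eta2).
have -> : eta / 2 * `|f - g| = `|(h f : dual Y) - h g|.
  rewrite /h opprD addrACA subrr add0r -scalerBr normrZ (gtr0_norm eta2).
  by rewrite opprB addrA subrK.
by apply: Sd; rewrite SU; split=> //; exact: hB.
Qed.

End refinement.

(** * Transfer of non-roughness along a linear isometry *)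

Section transfer.
Context {R : realType} {Y X : normedModType R} (j : {linear Y -> X}).
Hypothesis j_le : forall y, `|j y| <= `|y|.
Hypothesis j_ge : forall y, `|y| <= `|j y|.

(** Norm-preserving extension: the cone is the graph of [g] carried over by [j], and its constraints
    at [z] and [- z] together force equality. *)
Lemma precomp_surjective (g : dual Y) :
  exists2 f : dual X, `|f| <= `|g| & precomp j_le f = g.
Proof.
pose C : set (X * R) := [set (j y, g y) | y in setT].
have coneC : cone C.
  split=> [|_ _ [y _ <-] [z _ <-]|t _ t0 [y _ <-]] /=.
  - by exists 0; rewrite ?linear0.
  - by exists (y + z); rewrite ?linearD.
  - by exists (t *: y); rewrite ?linearZ.
have [|f fg Cf] := hahn_banach_dual (normr_ge0 g) coneC.
  move=> _ [y _ <-] /=; apply: le_trans (ler_norm _) _.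
  by apply: le_trans (dual_le_norm g y) _; rewrite ler_wpM2l.
exists f => //; apply/val_inj/funext => y /=; apply/eqP; rewrite eq_le.
have Cj z : g z <= f (j z) by apply: (Cf (j z, g z)); exists z.
rewrite Cj andbT -lerN2 -[leLHS](linearN g) -[leRHS](linearN f) -(linearN j).
exact: Cj.
Qed.

Variables (P : {linear dual X -> dual X}) (D : set (dual X)) (y0 : Y).
Hypothesis y0_neq0 : y0 != 0.
Hypothesis P_le : forall f, `|P f| <= `|precomp j_le f|.
Hypothesis D_ball : D `<=` unit_ball (dual X).
Hypothesis D_dense : unit_ball (dual X) `<=` closure (D : set (wstar X)).
Hypothesis D_P : forall f, D f -> `|f - P f| <= 1 - `|precomp j_le f|.

(** Density of [D], applied to [U] cut by the w*-open strip of functionals whose value at [x] is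
    within [r] of [f x]. *)
Lemma wstar_dense_approx (U : set (wstar X)) (f : dual X) x (r : R) :
  open U -> U f -> unit_ball (dual X) f -> 0 < r ->
  exists g : dual X, [/\ D g, U g & `|g x - f x| < r].
Proof.
move=> oU Uf f1 r0.
pose W : set (wstar X) := [set g | f x - r < dual_fun g x] `&`
  ((fun g : wstar X => dual_fun g x : R^o) @^-1` [set c | c < f x + r]).
have oW : open W.
  apply: openI; first exact: open_wstar_gt.
  have /continuousP := @wstar_eval_continuous R X x; apply; exact: open_lt.
have UWf : nbhs (f : wstar X) (U `&` W).
  apply: open_nbhs_nbhs; split; first exact: openI.
  by split=> //; rewrite /W; split; rewrite /= ?ltrBlDr ltrDl.
have [g [Dg [Ug [/= gr1 gr2]]]] := D_dense f1 UWf.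
by exists g; split=> //; rewrite ltr_norml; apply/andP; split; lra.
Qed.

Section bound.
Variables (n : nat) (lam : 'I_n -> R) (eta e : R).
Hypothesis lam_ge0 : forall i, 0 <= lam i.
Hypothesis lam_sum1 : \sum_i lam i = 1.
Variable S : 'I_n -> set (dual X).
Hypothesis S_large : forall i f, S i f -> 1 - eta < `|precomp j_le f|.
Hypothesis S_small : forall f g : 'I_n -> dual X,
  (forall i, S i (f i)) -> (forall i, S i (g i)) ->
  `|\sum_i lam i *: precomp j_le (f i) - \sum_i lam i *: precomp j_le (g i)|
    <= e.

(** Each [f i] has defect at most [1 - |precomp j_le (f i)| < eta], and the weights sum to 1. *)
Let combination_defect (f : 'I_n -> dual X) :
  (forall i, S i (f i)) -> (forall i, D (f i)) ->
  `|\sum_i lam i *: f i - P (\sum_i lam i *: f i)| <= eta.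
Proof.
move=> Sf Df; rewrite linear_sum -sumrB; apply: le_trans (ler_norm_sum _ _ _) _.
have -> : eta = \sum_i lam i * eta by rewrite -mulr_suml lam_sum1 mul1r.
apply: ler_sum => i _; rewrite linearZ/= -scalerBr normrZ ger0_norm//.
by rewrite ler_wpM2l//; have := D_P (Df i); have := S_large (Sf i); lra.
Qed.

Let combination_bound_dense (f g : 'I_n -> dual X) :
  (forall i, S i (f i)) -> (forall i, S i (g i)) ->
  (forall i, D (f i)) -> (forall i, D (g i)) ->
  `|\sum_i lam i *: f i - \sum_i lam i *: g i| <= e + 2 * eta.
Proof.
move=> Sf Sg Df Dg; have F := combination_defect Sf Df.
have G := combination_defect Sg Dg; have FG := S_small Sf Sg.
set u := \sum_i lam i *: f i in F *; set v := \sum_i lam i *: g i in G *.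
have Puv : `|P (u - v)| <= e.
  have precomp_sum (h : 'I_n -> dual X) : precomp j_le (\sum_i lam i *: h i) =
      \sum_i lam i *: precomp j_le (h i).
    by rewrite linear_sum; apply: eq_bigr => i _; rewrite linearZ.
  by apply: le_trans (P_le _) _; rewrite linearB/= /u /v !precomp_sum.
(* The first term is controlled by [S_small] through [P_le]; the other two are defects, of norm at
   most [eta] each. *)
have -> : u - v = P (u - v) + ((u - P u) - (v - P v)).
  by rewrite linearB/= opprB addrACA subrKC addKr.
have := ler_normD (P (u - v)) ((u - P u) - (v - P v)).
have := ler_normB (u - P u) (v - P v); lra.
Qed.

(** Density of [D] is only w*, so the norm is tested at one [x] at a time: replacing each functional
    by a member of [D] in the same [U i] changes the value of each combination at [x] by at most
    [r / 2]. *)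
Lemma combination_bound (U : 'I_n -> set (wstar X)) :
  (forall i, open (U i)) -> (forall i, S i = U i `&` unit_ball (dual X)) ->
  forall f g : 'I_n -> dual X,
  (forall i, S i (f i)) -> (forall i, S i (g i)) ->
  `|\sum_i lam i *: f i - \sum_i lam i *: g i| <= e + 2 * eta.
Proof.
move=> oU SU f g Sf Sg; apply: dual_norm_le => x x1; apply/ler_addgt0Pr => r r0.
have approx (h : 'I_n -> dual X) : (forall i, S i (h i)) ->
    exists h' : 'I_n -> dual X, [/\ forall i, S i (h' i), forall i, D (h' i) &
      `|(\sum_i lam i *: h' i) x - (\sum_i lam i *: h i) x| <= r / 2].
  move=> Sh; have r2 : 0 < r / 2 by rewrite divr_gt0.
  have /choice[h' h'P] : forall i, exists k : dual X,
      [/\ D k, U i k & `|k x - h i x| < r / 2].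
    move=> i; have := Sh i; rewrite SU => -[Uh h1].
    exact: wstar_dense_approx.
  exists h'; split=> [i|i|]; [|by case: (h'P i)|].
    by rewrite SU; case: (h'P i) => /D_ball.
  rewrite !dual_sumE -sumrB; apply: le_trans (ler_norm_sum _ _ _) _.
  have -> : r / 2 = \sum_i lam i * (r / 2) by rewrite -mulr_suml lam_sum1 mul1r.
  apply: ler_sum => i _.
  have -> : (lam i *: h' i : dual X) x - (lam i *: h i : dual X) x =
    lam i * (h' i x - h i x) by rewrite mulrBr.
  rewrite normrM ger0_norm// ler_wpM2l//; apply/ltW; by case: (h'P i).
have [f' [Sf' Df' ff']] := approx f Sf; have [g' [Sg' Dg' gg']] := approx g Sg.
have := combination_bound_dense Sf' Sg' Df' Dg'.
set u := \sum_i _ *: f i in ff' *; set v := \sum_i _ *: g i in gg' *.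
set u' := \sum_i _ *: f' i in ff' *; set v' := \sum_i _ *: g' i in gg' *.
have uv : (u' - v') x <= `|u' - v'|.
  apply: le_trans (ler_norm _) _; exact: (@opnorm_ub _ _ (u' - v') x x1).
move: uv ff' gg'; rewrite !ler_norml.
have -> : (u' - v') x = u' x - v' x by [].
have -> : (u - v) x = u x - v x by [].
lra.
Qed.

End bound.

Lemma slice_combination_transfer n (lam : 'I_n -> R) (S : 'I_n -> set (dual Y))
    (d eta : R) :
  (forall i, 0 <= lam i) -> \sum_i lam i = 1 -> 0 < eta ->
  (forall i, is_wstar_slice (S i)) ->
  (forall f g : 'I_n -> dual Y, (forall i, S i (f i)) -> (forall i, S i (g i)) ->
    `|\sum_i lam i *: f i - \sum_i lam i *: g i| <= d) ->
  exists T : 'I_n -> set (dual X), (forall i, is_wstar_slice (T i)) /\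
    forall f g : 'I_n -> dual X, (forall i, T i (f i)) -> (forall i, T i (g i)) ->
    `|\sum_i lam i *: f i - \sum_i lam i *: g i| <= d + 2 * eta.
Proof.
move=> lam0 lam1 eta0 sS Sd.
have /choice[y /choice[a ya]] : forall i, exists y (a : R), [/\ 0 < a,
    wstar_slice y a `<=` S i &
    forall f : dual Y, wstar_slice y a f -> 1 - eta < `|f|].
  by move=> i; exact: wstar_slice_refine y0_neq0 eta0 (sS i).
(* Since [|y| <= |j y|], a slice at [j y] restricts into the slice at [y] of the same width. *)
pose T i : set (dual X) := wstar_slice (j (y i)) (a i).
have sT i : is_wstar_slice (T i).
  by exists (j (y i)), (a i); case: (ya i).
have TS i f : T i f -> wstar_slice (y i) (a i) (precomp j_le f).
  rewrite /T !wstar_sliceE => -[f1 fy]; split.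
    exact: le_trans (precomp_norm_le _ _) f1.
  by apply: le_lt_trans fy; rewrite lerD2r j_ge.
exists T; split=> // f g Tf Tg.
have /choice[U /all_and2[oU TU]] : forall i, exists U : set (wstar X),
    open U /\ T i = U `&` unit_ball (dual X).
  by move=> i; have [U ? ?] := wstar_slice_open (sT i); exists U.
apply: (@combination_bound _ _ _ _ lam0 lam1 T _ _ U oU TU) => //.
  by move=> i h Th; case: (ya i) => _ _; apply; exact: TS.
by move=> h k Th Tk; apply: Sd => i; case: (ya i) => _ + _; apply; exact: TS.
Qed.

Lemma non_rough_transfer : non_rough Y -> non_rough X.
Proof.
move=> nY [eps eps0 rX]; apply: nY; exists (eps / 4); first by rewrite divr_gt0.
move=> S sS; apply: contrapT => /le_diameterN Sd.
have e4 : 0 < eps / 4 by rewrite divr_gt0.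
(* A single slice is a combination with one term; with [d = eta = eps / 4] the resulting diameter is
   at most [3 * eps / 4 < eps]. *)
have := @slice_combination_transfer 1 (fun=> 1) (fun=> S) (eps / 4) _
  (fun=> ler01) _ e4 (fun=> sS).
case; rewrite ?big_ord1//.
  by move=> f g Sf Sg; rewrite !big_ord1 !scale1r; exact: Sd.
move=> T [sT Td]; have := rX _ (sT ord0); apply/negP; rewrite -ltNge.
apply: (@le_lt_trans _ _ (eps / 4 + 2 * (eps / 4))%:E); last by rewrite lte_fin; lra.
apply: diameter_le => f g Tf Tg.
have := Td (fun=> f) (fun=> g); rewrite !big_ord1 !scale1r.
by apply=> i; rewrite ord1.
Qed.

Lemma average_non_rough_transfer : average_non_rough Y -> average_non_rough X.
Proof.
move=> nY [eps eps0 rX]; apply: nY; exists (eps / 4); first by rewrite divr_gt0.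
move=> _ [n [lam [S [lam0 lam1 sS ->]]]]; apply: contrapT => /le_diameterN Sd.
have e4 : 0 < eps / 4 by rewrite divr_gt0.
have [||T [sT Td]] := @slice_combination_transfer n lam S (eps / 4) _ _ lam1 e4 sS.
- by move=> i; exact: ltW.
- by move=> f g Sf Sg; apply: Sd; [exists f|exists g].
have cT : is_convex_combination_of_slices
    [set \sum_i lam i *: f i | f in [set f | forall i, T i (f i)]].
  by exists n, lam, T.
have := rX _ cT; apply/negP; rewrite -ltNge.
apply: (@le_lt_trans _ _ (eps / 4 + 2 * (eps / 4))%:E); last by rewrite lte_fin; lra.
by apply: diameter_le => _ _ [f Tf <-] [g Tg <-]; exact: Td.
Qed.

Lemma weakly_average_non_rough_transfer :
  weakly_average_non_rough Y -> weakly_average_non_rough X.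
Proof.
move=> nY [eps eps0 rX]; apply: nY.
pose eta := Num.min 1 (eps / 4).
have eta0 : 0 < eta by rewrite lt_min ltr01 divr_gt0.
have eta1 : eta <= 1 by rewrite ge_min lexx.
have eta_eps : eta <= eps / 4 by rewrite ge_min lexx orbT.
(* The factor [eta / 2] pays for the affine change of variable in [wstar_open_refine]. *)
exists (eta / 2 * (eps / 4)); first by rewrite mulr_gt0 ?divr_gt0.
move=> S S0 oS; apply: contrapT => /le_diameterN Sd.
have [U [oU [g0 [Ug0 g01 g0eta]] Ud]] :=
  wstar_open_refine y0_neq0 eta0 eta1 S0 oS Sd.
have [y y1 gy] := dual_norm_gt g0eta.
have [f0 f0g fg0] := precomp_surjective g0.
(* The half-space at [j y] keeps restrictions of norm above [1 - eta] in the ball, since [|y| <= 1];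
   an extension [f0] of [g0] shows that the set is nonempty. *)
pose W : set (wstar X) := (precomp j_le : wstar X -> wstar Y) @^-1` U `&`
  [set f | 1 - eta < dual_fun f (j y)].
have oW : open W.
  apply: openI; last exact: open_wstar_gt.
  by have /continuousP := @precomp_wstar_continuous _ _ _ _ j_le; apply.
pose T : set (dual X) := W `&` unit_ball (dual X).
have T0 : T !=set0.
  exists f0; split; last exact: le_trans f0g g01.
  split; first by rewrite /preimage /= fg0.
  by rewrite /= -[f0 (j y)]/(precomp j_le f0 y) fg0.
have oT : relatively_wstar_open T by exists W.
have := rX _ T0 oT; apply/negP; rewrite -ltNge.
apply: (@le_lt_trans _ _ (eps / 4 + 2 * eta)%:E); last by rewrite lte_fin; lra.
apply: diameter_le => f g Tf Tg.
have T_ball (h : dual X) : T h -> unit_ball (dual Y) (precomp j_le h).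
  by move=> [_ h1]; exact: le_trans (precomp_norm_le _ _) h1.
have := @combination_bound 1 (fun=> 1) eta (eps / 4) (fun=> ler01) _ (fun=> T)
  _ _ (fun=> W) (fun=> oW) (fun=> erefl) (fun=> f) (fun=> g) (fun=> Tf) (fun=> Tg).
rewrite !big_ord1 !scale1r; apply=> //.
- move=> _ h [[_ hy] _]; apply: lt_le_trans hy _.
  apply: le_trans (ler_norm _) _.
  exact: (@opnorm_ub _ _ (precomp j_le h) y y1).
- move=> h k Th Tk; rewrite !big_ord1 !scale1r.
  have := Th ord0; have := Tk ord0 => Tk0 Th0.
  by apply: Ud; [exact: T_ball|exact: T_ball|case: Th0 => -[]|case: Tk0 => -[]].
Qed.

End transfer.

(** * Projections attached to M-ideals and strict ideals *)

Lemma opnorm1_contraction (R : realType) (V W : normedModType R)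
  (Q : {linear V -> W}) :
  opnorm Q = 1 -> forall x, `|Q x| <= `|x|.
Proof.
move=> Q1 x; have [->|x0] := eqVneq x 0; first by rewrite linear0 !normr0.
have hQ : has_sup [set `|Q x| | x in unit_ball V].
  (* Without a supremum, [sup] would take its default value 0 rather than 1. *)
  apply: contrapT => /sup_out QN; move: Q1; rewrite /opnorm QN => /eqP.
  by rewrite eq_sym oner_eq0.
have nx : 0 < `|x| by rewrite normr_gt0.
have : `|Q (`|x|^-1 *: x)| <= 1.
  rewrite -Q1; apply: sup_upper_bound => //; exists (`|x|^-1 *: x) => //.
  by rewrite /unit_ball /= normrZ normfV normr_id mulVf ?gt_eqF.
by rewrite linearZ/= normrZ normfV normr_id ler_pdivrMl// mulr1.
Qed.

Section ideal_projections.
Context {R : realType} {X : normedModType R} (Y : closed_subspace X).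

Lemma subspace_val_le (y : subspace_type Y) : `|\val y| <= `|y|.
Proof. exact: lexx. Qed.

Lemma subspace_val_ge (y : subspace_type Y) : `|y| <= `|\val y|.
Proof. exact: lexx. Qed.

Definition restriction : dual X -> dual (subspace_type Y) :=
  precomp (j := \val : {linear subspace_type Y -> X}) subspace_val_le.

HB.instance Definition _ := GRing.Linear.on restriction.

Lemma annihilatorE f : annihilator Y f <-> restriction f = 0.
Proof.
split=> [fY|fY y Yy].
  by apply/val_inj/funext => y; apply: fY; exact: set_mem (subspace_valP y).
have := congr1 (fun g : dual _ => g (SubspaceElt (mem_set Yy))) fY; exact.
Qed.

(** For [Y = 0] the annihilator is the whole dual, so [P = 0] cannot have norm 1. This supplies the
    nonzero vector used in the transfer. *)
Lemma ideal_nontrivial : is_ideal Y -> exists y : subspace_type Y, y != 0.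
Proof.
move=> [P [[_ kerP] P1]]; apply: contrapT => Y0.
have P0 f : P f = 0.
  suff : annihilator Y f by rewrite -kerP.
  apply/annihilatorE/val_inj/funext => y.
  have [->|y0] := eqVneq y 0; first exact: linear0.
  by exfalso; apply: Y0; exists y.
move: P1; rewrite /opnorm.
have -> : [set `|P f| | f in unit_ball (dual X)] = [set 0].
  apply/seteqP; split=> [_ [f _ <-]|_ ->]; first by rewrite P0 normr0.
  by exists 0; rewrite /unit_ball /= ?linear0 normr0.
by rewrite sup1 => /eqP; rewrite eq_sym oner_eq0.
Qed.

Section projection.
Variable P : {linear dual X -> dual X}.
Hypothesis projP : projection_along_annihilator Y P.

Lemma restriction_projection f : restriction (P f) = restriction f.
Proof.
have [PP kerP] := projP; have : annihilator Y (f - P f).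
  by rewrite -kerP /= linearB/= PP subrr.
by move=> /annihilatorE; rewrite linearB/= => /subr0_eq ->.
Qed.

(** [P f] depends only on the restriction of [f], so [f] may be replaced by a norm-preserving
    extension of that restriction. *)
Lemma projection_le_restriction : (forall f, `|P f| <= `|f|) ->
  forall f, `|P f| <= `|restriction f|.
Proof.
move=> Ple f; have [g gf rg] := precomp_surjective
  (j := \val : {linear subspace_type Y -> X}) subspace_val_le subspace_val_ge
  (restriction f).
suff -> : P f = P g by apply: le_trans (Ple g) gf.
apply/eqP; rewrite -subr_eq0 -linearB; apply/eqP.
have [_ kerP] := projP.
suff : annihilator Y (f - g) by rewrite -kerP.
by apply/annihilatorE; rewrite linearB/= [restriction g]rg subrr.
Qed.

End projection.

Lemma M_ideal_transfer : is_ideal Y -> is_M_ideal Y ->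
  [/\ non_rough (subspace_type Y) -> non_rough X,
      weakly_average_non_rough (subspace_type Y) -> weakly_average_non_rough X &
      average_non_rough (subspace_type Y) -> average_non_rough X].
Proof.
move=> /ideal_nontrivial[y0 y00] [P [projP PM]].
have Ple f : `|P f| <= `|f| by rewrite [leRHS]PM lerDl.
have Pr := projection_le_restriction projP Ple.
have dense : unit_ball (dual X) `<=`
  closure (unit_ball (dual X) : set (wstar X)) by exact: (@subset_closure (wstar X)).
(* The norm decomposition gives [|f - P f| = |f| - |P f|], and [P f] has the same restriction as
   [f], hence at least its norm. *)
have defect f : unit_ball (dual X) f -> `|f - P f| <= 1 - `|restriction f|.
  move=> f1; rewrite -(restriction_projection projP).
  have := precomp_norm_le subspace_val_le (P f).
  by have := PM f; move: f1; rewrite /unit_ball /restriction /=; lra.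
split.
- exact: (non_rough_transfer subspace_val_ge y00 Pr (fun _ => id) dense defect).
- exact: (weakly_average_non_rough_transfer subspace_val_ge y00 Pr (fun _ => id)
    dense defect).
- exact: (average_non_rough_transfer subspace_val_ge y00 Pr (fun _ => id) dense
    defect).
Qed.

Lemma strict_ideal_transfer : is_ideal Y -> is_strict_ideal Y ->
  [/\ non_rough (subspace_type Y) -> non_rough X,
      weakly_average_non_rough (subspace_type Y) -> weakly_average_non_rough X &
      average_non_rough (subspace_type Y) -> average_non_rough X].
Proof.
move=> /ideal_nontrivial[y0 y00] [P [projP P1 dense]].
have Pr := projection_le_restriction projP (opnorm1_contraction P1).
have ball : range P `&` unit_ball (dual X) `<=` unit_ball (dual X) by move=> f [].
(* Idempotence makes the defect zero on the range of [P]. *)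
have defect f : (range P `&` unit_ball (dual X)) f ->
    `|f - P f| <= 1 - `|restriction f|.
  move=> [[g _ <-] Pg1]; rewrite (proj1 projP) subrr normr0 subr_ge0.
  exact: le_trans (precomp_norm_le _ _) Pg1.
split.
- exact: (non_rough_transfer subspace_val_ge y00 Pr ball dense defect).
- exact: (weakly_average_non_rough_transfer subspace_val_ge y00 Pr ball dense
    defect).
- exact: (average_non_rough_transfer subspace_val_ge y00 Pr ball dense defect).
Qed.

End ideal_projections.

(** * The zero space, and continuous functions near an isolated point *)

Lemma trivial_space_non_rough (R : realType) (Z : normedModType R) :
  (forall z : Z, z = 0) ->
  [/\ non_rough Z, weakly_average_non_rough Z & average_non_rough Z].
Proof.
move=> Z0; have dualE (f g : dual Z) : f = g.
  by apply/val_inj/funext => z; rewrite (Z0 z) [LHS](linear0 f) [RHS](linear0 g).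
have small (S : set (dual Z)) (eps : R) : 0 < eps -> ~ (eps%:E <= diameter S)%E.
  move=> eps0; apply/negP; rewrite -ltNge.
  apply: (@le_lt_trans _ _ 0%:E); last by rewrite lte_fin.
  by apply: diameter_le => f g _ _; rewrite (dualE f g) subrr normr0.
have slice : is_wstar_slice (wstar_slice (0 : Z) 1) by exists 0, 1.
split=> -[eps eps0 rZ]; apply: (small _ _ eps0).
- exact: rZ slice.
- apply: (rZ (unit_ball (dual Z))); first by exists 0; rewrite /unit_ball /= normr0.
  by exists setT; [exact: openT|rewrite setTI].
- apply: rZ; exists 1%N, (fun=> 1), (fun=> wstar_slice (0 : Z) 1).
  by split=> //; rewrite big_ord1.
Qed.

Section isolated_point.
Context {R : realType} {K : topologicalType} (cK : compact [set: K])
  (X : normedModType R) (k : K).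
Hypothesis hK : hausdorff_space K.
Hypothesis isoK : isolated [set: K] k.

(** The function is locally constant: the singleton of [k] is open by isolation and closed by
    separation. *)
Lemma point_mass_continuous (x : X) :
  (fun t : K => if t == k then x else 0) \in cts_pred K X.
Proof.
rewrite inE => t; apply: cvg_near_cst.
have [->|tk] := eqVneq t k.
  have [_ [V kV Vk]] := isoK.
  apply: filterS kV => s Vs; have : (V `&` setT) s by [].
  by rewrite Vk => ->; rewrite eqxx.
have : open_nbhs t (~` [set k]).
  split; last by move=> /eqP; apply/negP.
  by apply/closed_openC/accessible_closed_set1/hausdorff_accessible.
move=> /open_nbhs_nbhs; apply: filterS => s /= /eqP sk.
by rewrite (negbTE sk).
Qed.

Definition point_mass (x : X) : cts_space cK X := CtsFun cK (point_mass_continuous x).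

Lemma point_mass_linear : linear point_mass.
Proof.
move=> a x y; apply/val_inj/funext => t /=.
rewrite -[RHS]/(a *: (if t == k then x else 0) + (if t == k then y else 0)).
by case: ifP => // _; rewrite scaler0 addr0.
Qed.

HB.instance Definition _ :=
  GRing.isLinear.Build R X (cts_space cK X) _ point_mass point_mass_linear.

Definition eval_at (f : cts_space cK X) : X := f k.

Lemma eval_at_linear : linear eval_at.
Proof. by []. Qed.

HB.instance Definition _ :=
  GRing.isLinear.Build R (cts_space cK X) X _ eval_at eval_at_linear.

Lemma eval_at_le (f : cts_space cK X) : `|eval_at f| <= `|f|.
Proof. exact: sup_norm_ub. Qed.

Lemma point_mass_le (x : X) : `|point_mass x| <= `|x|.
Proof. by apply: sup_norm_le => // t /=; case: ifP => // _; rewrite normr0. Qed.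

Lemma point_mass_ge (x : X) : `|x| <= `|point_mass x|.
Proof. by have := sup_norm_ub (point_mass x) k; rewrite /= eqxx. Qed.

Lemma isolated_point_transfer :
  [/\ non_rough X -> non_rough (cts_space cK X),
      weakly_average_non_rough X -> weakly_average_non_rough (cts_space cK X) &
      average_non_rough X -> average_non_rough (cts_space cK X)].
Proof.
(* The transfer lemmas require a nonzero vector; if [X] is zero, so is the function space. *)
have [[x0 x00]|X0] := pselect (exists x : X, x != 0); last first.
  have [|? ? ?] := @trivial_space_non_rough R (cts_space cK X); last by split.
  move=> f; apply/val_inj/funext => t; apply: contrapT => /eqP ft.
  by apply: X0; exists (f t).
pose P : {linear dual (cts_space cK X) -> dual (cts_space cK X)} :=
  precomp eval_at_le \o precomp point_mass_le.
have Ple f : `|P f| <= `|precomp point_mass_le f| by exact: precomp_norm_le.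
have dense : unit_ball (dual (cts_space cK X)) `<=`
    closure (unit_ball (dual (cts_space cK X)) : set (wstar (cts_space cK X))).
  exact: (@subset_closure (wstar _)).
have defect f : unit_ball (dual (cts_space cK X)) f ->
    `|f - P f| <= 1 - `|precomp point_mass_le f|.
  (* Testing [f - P f] at [v] and the adjoint at [x] adds up to the value of [f] at one function,
     equal to [x] at [k] and to [v] elsewhere, hence of norm at most 1. *)
  move=> f1; apply: dual_norm_le => v v1; rewrite lerBrDr -lerBrDl.
  apply: dual_norm_le => x x1; rewrite lerBrDl.
  rewrite -[(f - P f) v]/(f v - f (point_mass (v k))).
  rewrite -[precomp _ _ x]/(f (point_mass x)) -linearB -linearD.
  apply: le_trans (dual_le1 _ f1) _; apply: sup_norm_le => // t.
  rewrite -[_ t]/(v t - (if t == k then v k else 0) + (if t == k then x else 0)).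
  have [->|_] := eqVneq t k; first by rewrite subrr add0r.
  by rewrite subr0 addr0; exact: le_trans (sup_norm_ub v t) v1.
split.
- exact: (non_rough_transfer point_mass_ge x00 Ple (fun _ => id) dense defect).
- exact: (weakly_average_non_rough_transfer point_mass_ge x00 Ple (fun _ => id)
    dense defect).
- exact: (average_non_rough_transfer point_mass_ge x00 Ple (fun _ => id) dense
    defect).
Qed.

End isolated_point.

Theorem proposition2p6 (R : realType) (X : completeNormedModType R) :
  (forall Y : closed_subspace X, is_ideal Y ->
    (is_M_ideal Y ->
      [/\ non_rough (subspace_type Y) -> non_rough X,
          weakly_average_non_rough (subspace_type Y) ->
            weakly_average_non_rough X &
          average_non_rough (subspace_type Y) -> average_non_rough X]) /\
    (is_strict_ideal Y ->
      [/\ non_rough (subspace_type Y) -> non_rough X,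
          weakly_average_non_rough (subspace_type Y) ->
            weakly_average_non_rough X &
          average_non_rough (subspace_type Y) -> average_non_rough X])) /\
  (forall (K : topologicalType) (cK : compact [set: K]),
    hausdorff_space K -> (exists k : K, isolated [set: K] k) ->
      [/\ non_rough X -> non_rough (cts_space cK X),
          weakly_average_non_rough X ->
            weakly_average_non_rough (cts_space cK X) &
          average_non_rough X -> average_non_rough (cts_space cK X)]).
Proof.
split=> [Y idealY|K cK hK [k isoK]]; last exact: isolated_point_transfer hK isoK.
by split=> ?; [exact: M_ideal_transfer|exact: strict_ideal_transfer].
Qed.
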